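(* Let $\mathbb K\in\{\mathbb R,\mathbb C\}$, let $\mathbf u,\mathbf v$ be sequences of non-zero scalars, and let $m_{\mathbf u}=\bigotimes_{n\ge0}\mu_{n,\mathbf u}$ and $m_{\mathbf v}=\bigotimes_{n\ge0}\mu_{n,\mathbf v}$ be product probability measures on $\mathbb K^{\mathbb Z_+}$, $B_{\mathbf u}$-invariant and $B_{\mathbf v}$-invariant respectively, with $\mu_{0,\mathbf u}(\{0\})=0=\mu_{0,\mathbf v}(\{0\})$. Assume $m_{\mathbf u}$ and $m_{\mathbf v}$ are not mutually singular, and set $\lambda_n=\frac{u_1\cdots u_n}{v_1\cdots v_n}$ for $n\ge1$. (1) If there is $a\in\mathbb K\setminus\{0\}$ such that $\mu_{0,\mathbf v}(A)=\mu_{0,\mathbf u}(aA)$ for every Borel set $A\subseteq\mathbb K$, then $\sum_{n=1}^\infty(1-|a^{-1}\lambda_n|)^2<\infty$. (2) If $\int_{\mathbb K\setminus\{0\}}(\log|t|)^2\,d\mu_{0,\mathbf u}(t)<\infty$ and $\int_{\mathbb K\setminus\{0\}}(\log|t|)^2\,d\mu_{0,\mathbf v}(t)<\infty$, then there exists $a\in\mathbb K\setminus\{0\}$ such that $\sum_{n=1}^\infty(1-|a^{-1}\lambda_n|)^2<\infty$.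
   Context: $\mathbb K^{\mathbb Z_+}$ carries the product topology and Borel $\sigma$-algebra; $B_{\mathbf w}:\mathbb K^{\mathbb Z_+}\to\mathbb K^{\mathbb Z_+}$ is $(B_{\mathbf w}t)_j=w_{j+1}t_{j+1}$, and invariance means $\mu(B_{\mathbf w}^{-1}B)=\mu(B)$ for Borel $B$. *)

(* Defs.v *)
From HB Require Import structures.
From mathcomp Require Import all_boot all_order all_algebra.
From mathcomp Require Import all_classical all_reals all_analysis.
From mathcomp.real_closed Require Import complex.
Set Implicit Arguments. Unset Strict Implicit. Unset Printing Implicit Defensive.
Import Order.TTheory GRing.Theory Num.Theory.
Import numFieldNormedType.Exports.
Local Open Scope classical_set_scope.
Local Open Scope ring_scope.

Inductive scalar_kind := RealK | ComplexK.

Definition Kfld (R : realType) (k : scalar_kind) : numFieldType :=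
  match k with RealK => R | ComplexK => (R[i] : numFieldType) end.

Definition absK (R : realType) (k : scalar_kind) : Kfld R k -> R :=
  match k return Kfld R k -> R with
  | RealK => fun t : R => `|t|
  | ComplexK => fun t : R[i] => Normc.normc t
  end.

(* nat -> K carries the product topology (topology of pointwise convergence) *)
Import ArrowAsProduct.

Definition KB (R : realType) (k : scalar_kind) :=
  g_sigma_algebraType (@open (Kfld R k)).
Definition KNB (R : realType) (k : scalar_kind) :=
  g_sigma_algebraType (@open (nat -> Kfld R k)).

Definition Bw (R : realType) (k : scalar_kind) (w : nat -> Kfld R k)
  (t : nat -> Kfld R k) : nat -> Kfld R k :=
  fun j => w j.+1 * t j.+1.

(* m is the product measure \bigotimes_n mu n: it agrees with the product of
   the mu_i on all measurable cylinders (this characterizes it uniquely). *)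
Definition is_product_measure (R : realType) (k : scalar_kind)
  (m : probability (KNB R k) R) (mu : nat -> probability (KB R k) R) : Prop :=
  forall (n : nat) (A : nat -> set (KB R k)),
    (forall i, measurable (A i)) ->
    m [set t : KNB R k | forall i, (i < n)%N -> A i (t i)] =
      (\prod_(i < n) mu i (A i))%E.

Definition shift_invariant (R : realType) (k : scalar_kind)
  (w : nat -> Kfld R k) (m : probability (KNB R k) R) : Prop :=
  forall B : set (KNB R k), measurable B ->
    m ((@Bw R k w) @^-1` B) = m B.

Definition mutually_singular (d : measure_display) (T : measurableType d)
  (R : realType) (m1 m2 : {measure set T -> \bar R}) : Prop :=
  exists S : set T, measurable S /\ m1 S = 0%E /\ m2 (~` S) = 0%E.

(* Main.v *)
(* By invariance, t_n has the law of X / (u_1 ... u_n) with X distributed as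
   mu_{0,u}.  Hence the variables ln |u_1 ... u_n t_n| are i.i.d. under m_u, and,
   once shifted by s_n = ln |lambda_n|, also under m_v.  For a function f of
   these variables let d_n be the difference of the two means of its value at
   coordinate n, the variances being bounded.  The means of the weighted sum
   with weights d_i, i < n, differ by D_n = sum_{i<n} d_i^2, while its variances
   are O(D_n); by Chebyshev and Borel-Cantelli, the measures are mutually
   singular if D_n is unbounded.  For (2) take f = id, so that d_n is s_n minus
   a constant.  For (1) take for f a truncation at a high level: it needs no
   moment assumption, and it still gives |d_n| >= min(|s_n|, 1) / 2. *)
Require Import Defs.
From HB Require Import structures.
From mathcomp Require Import all_boot all_order all_algebra.
From mathcomp Require Import all_classical all_reals all_analysis.
From mathcomp.real_closed Require Import complex.
From mathcomp Require Import measurable_realfun ring lra.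
Set Implicit Arguments. Unset Strict Implicit. Unset Printing Implicit Defensive.
Import Order.TTheory GRing.Theory Num.Theory.
Import numFieldNormedType.Exports.
Local Open Scope classical_set_scope.
Local Open Scope ring_scope.

(** * Mutual singularity from approximate separation *)

Lemma separated_mutually_singular (d : measure_display) (T : measurableType d)
    (R : realType) (P Q : probability T R) :
  (forall e : R, 0 < e -> exists A : set T,
     [/\ measurable A, (P A <= e%:E)%E & (Q (~` A) <= e%:E)%E]) ->
  mutually_singular P Q.
Proof.
move=> sep.
have half_gt0 n : (0 : R) < 1 / (2 ^ n.+1)%:R by rewrite divr_gt0// ltr0n expn_gt0.
have /choice[A HA] n := sep _ (half_gt0 n).
have mA n : measurable (A n) by case: (HA n).
have mC n : measurable (\bigcap_(j in [set j | (n <= j)%N]) ~` A j).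
  by apply: bigcap_measurable => // [|j _]; [exists n => /=|exact: measurableC].
exists (lim_sup_set A); split; [|split].
- by apply: bigcap_measurable => // n _; exact: bigcup_measurable.
- apply: lim_sup_set_cvg0 => //.
  apply: (@le_lt_trans _ _ 1%E); last exact: ltry.
  apply: le_trans (epsilon_trick0 xpredT ler01).
  by apply: lee_nneseries => // n _; case: (HA n).
- rewrite /lim_sup_set setC_bigcap.
  under eq_bigcupr do rewrite setC_bigcup.
  apply: measure_negligible; first exact: bigcup_measurable.
  apply: negligible_bigcup => n; apply/negligibleP => //.
  apply/eqP; rewrite eq_le measure_ge0 andbT; apply/lee_addgt0Pr => e e0.
  rewrite add0e; have [N _ HN] := near_infty_natSinv_lt (PosNum e0).
  pose j := maxn n N; apply: (@le_trans _ _ (Q (~` A j))).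
    apply: le_measure; rewrite ?inE//; first exact: measurableC.
    by apply: bigcap_inf => /=; rewrite leq_maxl.
  have [_ _ /le_trans] := HA j; apply; rewrite lee_fin.
  apply: le_trans (ltW (HN j _)); last by rewrite /= leq_maxr.
  by rewrite div1r lef_pV2 ?posrE ?ltr0n ?expn_gt0// ler_nat ltnW// ltn_expl.
Qed.

Lemma Lfun_measurable (d : measure_display) (T : measurableType d)
    (R : realType) (P : probability T R) (f : T -> R) (p : \bar R) :
  f \in Lfun P p -> measurable_fun setT f.
Proof. by rewrite inE => /andP[]; rewrite inE. Qed.

(** * Weighted sums of pairwise uncorrelated variables *)

Section uncorrelated.
Local Open Scope ereal_scope.
Context d (T : measurableType d) (R : realType) (P : probability T R).
Implicit Types (X : nat -> T -> R) (c : nat -> R).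

Lemma Lfun2_sum X c n : (forall i, X i \in Lfun P 2%:E) ->
  (\sum_(i < n) (c i \o* X i))%R \in Lfun P 2%:E.
Proof.
move=> X2; elim: n => [|n IH].
  by rewrite big_ord0 (_ : 0%R = cst 0%R)// Lfun_cst.
by rewrite big_ord_recr/= rpredD ?lee1n//= Lfun_scale ?ler1n.
Qed.

Lemma expectation_sumZ X c n : (forall i, X i \in Lfun P 2%:E) ->
  fine 'E_P[(\sum_(i < n) (c i \o* X i))%R] =
  (\sum_(i < n) c i * fine 'E_P[X i])%R.
Proof.
move=> X2; elim: n => [|n IH].
  by rewrite !big_ord0 (_ : 0%R = cst 0%R)// expectation_cst.
have fP := fin_num_measure P _ measurableT.
have X1 i : X i \in Lfun P 1 := Lfun_subset12 fP (X2 i).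
have S1 := Lfun_subset12 fP (Lfun2_sum c n X2).
rewrite !big_ord_recr/= expectationD//; last by rewrite Lfun_scale.
rewrite expectationZl// fineD ?fin_numM ?expectation_fin_num//.
by rewrite fineM ?expectation_fin_num// IH.
Qed.

Lemma covariance_sumZ X c n Y : (forall i, X i \in Lfun P 2%:E) ->
  Y \in Lfun P 2%:E -> (forall i, (i < n)%N -> covariance P (X i) Y = 0) ->
  covariance P (\sum_(i < n) (c i \o* X i))%R Y = 0.
Proof.
move=> X2 Y2; have fP := fin_num_measure P _ measurableT.
elim: n => [|n IH] cov0.
  by rewrite big_ord0 (_ : 0%R = cst 0%R)// covariance_cst_l.
have X1 := Lfun_subset12 fP (X2 n).
have Y1 := Lfun_subset12 fP Y2.
rewrite big_ord_recr/= covarianceDl ?Lfun2_sum ?Lfun_scale ?ler1n//.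
rewrite IH ?add0e => [|i ilt]; last by rewrite cov0// ltnS ltnW.
by rewrite covarianceZl ?Lfun2_mul_Lfun1// cov0// mule0.
Qed.

Lemma variance_sumZ X c n : (forall i, X i \in Lfun P 2%:E) ->
  (forall i j, (i < j)%N -> covariance P (X i) (X j) = 0) ->
  'V_P[(\sum_(i < n) (c i \o* X i))%R] = \sum_(i < n) (c i ^+ 2)%:E * 'V_P[X i].
Proof.
move=> X2 cov0; have fP := fin_num_measure P _ measurableT.
elim: n => [|n IH].
  by rewrite !big_ord0 (_ : 0%R = cst 0%R)// variance_cst.
have Xn1 := Lfun_subset12 fP (X2 n).
have S2 := Lfun2_sum c n X2.
have S1 := Lfun_subset12 fP S2.
rewrite !big_ord_recr/= varianceD ?Lfun_scale ?ler1n// IH varianceZ//.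
rewrite covarianceZr ?Lfun2_mul_Lfun1// covariance_sumZ ?mule0 ?adde0//.
by move=> i; exact: cov0.
Qed.

Lemma chebyshev_sumZ X c n (C e : R) : (0 < e)%R ->
  (forall i, X i \in Lfun P 2%:E) ->
  (forall i j, (i < j)%N -> covariance P (X i) (X j) = 0) ->
  (forall i, 'V_P[X i] <= C%:E) ->
  P [set x | e <= `|(\sum_(i < n) (c i \o* X i)) x -
                    \sum_(i < n) c i * fine 'E_P[X i]|]%R <=
  (e ^- 2 * (C * \sum_(i < n) c i ^+ 2))%:E.
Proof.
move=> e0 X2 cov0 VC; rewrite -expectation_sumZ//.
have S2 := Lfun2_sum c n X2.
have := @chebyshev _ _ _ P (mfun_Sub (sub_Lfun_mfun S2)) _ e0.
move=> /le_trans; apply.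
rewrite [leRHS]EFinM lee_pmul2l ?lte_fin ?invr_gt0 ?exprn_gt0//=.
rewrite [leLHS](_ : _ = 'V_P[(\sum_(i < n) (c i \o* X i))%R])//.
rewrite variance_sumZ// mulr_sumr -sumEFin; apply: lee_sum => i _.
by rewrite [leRHS]EFinM [leLHS]muleC lee_wpmul2r// lee_fin sqr_ge0.
Qed.

End uncorrelated.

(** * The second-moment criterion for singularity *)

(** By contraposition. With the differences of the means as weights, the gap between the two means
    of the weighted sum is D itself, while both variances are at most C D. Chebyshev then leaves
    errors of at most 4C/D, which become small when D is unbounded. *)
Lemma not_singular_sum_le (d : measure_display) (T : measurableType d)
    (R : realType) (P Q : probability T R) (X : nat -> T -> R) (C : R) :
  (forall i, X i \in Lfun P 2%:E) -> (forall i, X i \in Lfun Q 2%:E) ->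
  (forall i j, (i < j)%N -> covariance P (X i) (X j) = 0%E) ->
  (forall i j, (i < j)%N -> covariance Q (X i) (X j) = 0%E) ->
  (forall i, 'V_P[X i] <= C%:E)%E -> (forall i, 'V_Q[X i] <= C%:E)%E ->
  ~ mutually_singular P Q ->
  exists M, forall n,
    \sum_(i < n) (fine 'E_Q[X i] - fine 'E_P[X i]) ^+ 2 <= M.
Proof.
move=> XP XQ covP covQ VP VQ; apply: contra_notP => nobound.
have C0 : 0 <= C by rewrite -lee_fin (le_trans _ (VP 0%N))// variance_ge0.
(* Chebyshev at distance D / 2, half the difference of the two means. *)
apply: separated_mutually_singular => e e0.
set c := fun i => fine 'E_Q[X i] - fine 'E_P[X i].
(* Beyond this threshold the Chebyshev error 4C/D is at most e. *)
have [n Dn] : exists n, 4 * (C + 1) / e < \sum_(i < n) c i ^+ 2.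
  apply: contrapT => h; apply: nobound; exists (4 * (C + 1) / e) => n.
  by rewrite leNgt; apply/negP => ?; apply: h; exists n.
set D := \sum_(i < n) c i ^+ 2 in Dn.
have D0 : 0 < D.
  by apply: le_lt_trans Dn; rewrite divr_ge0 ?(ltW e0)// mulr_ge0 ?addr_ge0.
have D20 : 0 < D / 2 by rewrite divr_gt0.
have DE : D = \sum_(i < n) c i * fine 'E_Q[X i] - \sum_(i < n) c i * fine 'E_P[X i].
  by rewrite -sumrB; apply: eq_bigr => i _; rewrite -mulrBr expr2.
have bound : (D / 2) ^- 2 * (C * D) <= e.
  have -> : (D / 2) ^- 2 * (C * D) = 4 * C / D by field; rewrite gt_eqF.
  rewrite ler_pdivrMr//; move: Dn; rewrite ltr_pdivrMr// => Dn; nra.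
pose A (m : R) := [set x | D / 2 <= `|(\sum_(i < n) (c i \o* X i)) x - m|].
have mA m : measurable (A m).
  rewrite (_ : A m = (fun x => `|(\sum_(i < n) (c i \o* X i)) x - m|) @^-1` `[D / 2, +oo[).
    have mS := Lfun_measurable (Lfun2_sum c n XP).
    rewrite -[X in measurable X]setTI; apply: measurableT_comp => //.
    exact: measurable_funB.
  by apply/seteqP; split => x; rewrite /A/= in_itv/= andbT.
exists (A (\sum_(i < n) c i * fine 'E_P[X i])); split => //.
  by apply: (le_trans (chebyshev_sumZ _ _ D20 XP covP VP)); rewrite lee_fin.
(* Where the sum is within D/2 of its [P]-mean, it is at distance more than D/2 from its [Q]-mean,
   since the means differ by D. *)
apply: (@le_trans _ _ (Q (A (\sum_(i < n) c i * fine 'E_Q[X i])))).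
  apply: le_measure; rewrite ?inE//; first exact: measurableC.
  move=> x /=; rewrite /A /= => /negP; rewrite -ltNge.
  set S := (\sum_(i < n) _) x; rewrite ltr_norml => /andP[_ h].
  by rewrite ler_normr; apply/orP; right; lra.
by apply: (le_trans (chebyshev_sumZ _ _ D20 XQ covQ VQ)); rewrite lee_fin.
Qed.

(** * Independence implies zero covariance *)

(** Independence makes the joint law of (X, Y) the product of the two laws, and Fubini then factors
    the mean of X Y. *)
Lemma independent_covariance0 (d : measure_display) (T : measurableType d)
    (R : realType) (P : probability T R) (X Y : T -> R) :
  X \in Lfun P 2%:E -> Y \in Lfun P 2%:E ->
  (forall A B : set R, measurable A -> measurable B ->
     P (X @^-1` A `&` Y @^-1` B) = (P (X @^-1` A) * P (Y @^-1` B))%E) ->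
  covariance P X Y = 0%E.
Proof.
move=> X2 Y2 indep; have fP := fin_num_measure P _ measurableT.
have X1 := Lfun_subset12 fP X2; have Y1 := Lfun_subset12 fP Y2.
have XY1 := Lfun2_mul_Lfun1 X2 Y2.
suff -> : covariance P X Y = ('E_P[X] * 'E_P[Y] - 'E_P[X] * 'E_P[Y])%E.
  by rewrite subee// fin_numM ?expectation_fin_num.
rewrite covarianceE//; congr (_ - _)%E.
pose X' : {mfun T >-> R} := mfun_Sub (sub_Lfun_mfun X2).
pose Y' : {mfun T >-> R} := mfun_Sub (sub_Lfun_mfun Y2).
have mX := Lfun_measurable X2.
have mY := Lfun_measurable Y2.
pose Z t : (R * R)%type := (X t, Y t).
have mZ : measurable_fun setT Z by exact: measurable_fun_pair.
pose Z' : {mfun T >-> (R * R)%type} := HB.pack Z (isMeasurableFun.Build _ _ _ _ Z mZ).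
pose f (z : R * R) : \bar R := (z.1 * z.2)%:E.
have mf : measurable_fun setT f.
  by apply/measurable_EFinP; apply: measurable_funM.
(* A product measure is determined by its values on rectangles, where the hypothesis gives the
   equality. *)
have lawE (A : set (R * R)) : measurable A -> 
   (distribution P X' \x distribution P Y')%E A = distribution P Z' A.
  by move=> mA; exact: product_measure_unique.
have intZ : P.-integrable setT (f \o Z) by exact/Lfun1_integrable.
(* Fubini needs integrability for the product law; it is carried over from that of X Y under [P]. *)
have intf : (distribution P X' \x distribution P Y')%E.-integrable setT f.
  apply/integrableP; split=> //.
  rewrite (eq_measure_integral (distribution P Z')); last by move=> A mA _; exact: lawE.
  rewrite ge0_integral_distribution//; last exact: measurableT_comp.
  by have /integrableP[] := intZ.
have -> : 'E_P[X * Y]%E = (\int[distribution P Z']_z f z)%E.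
  by rewrite integral_distribution// unlock.
rewrite (eq_measure_integral (distribution P X' \x distribution P Y')%E); last first.
  by move=> A mA _; exact/esym/lawE.
rewrite -integral12_prod_meas1// /fubini_F.
have mabs : measurable_fun setT (abse \o @EFin R).
  by apply: measurableT_comp => //; exact: abse_measurable.
have abs0 (y : R) : (0 <= (abse \o EFin) y)%E by exact: abse_ge0.
have EX : 'E_P[X]%E = (\int[distribution P X']_x x%:E)%E.
  rewrite (@integral_distribution _ _ _ _ _ P X' EFin)//; first by rewrite unlock.
  exact/Lfun1_integrable.
have EY : 'E_P[Y]%E = (\int[distribution P Y']_x x%:E)%E.
  rewrite (@integral_distribution _ _ _ _ _ P Y' EFin)//; first by rewrite unlock.
  exact/Lfun1_integrable.
rewrite (eq_integral (fun x : R => x%:E * 'E_P[Y])%E) => [|x _].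
  rewrite EX -(fineK (expectation_fin_num Y1)) integralZr//.
  apply/integrableP; split; first exact/measurable_EFinP.
  rewrite (@ge0_integral_distribution _ _ _ _ _ P X' (abse \o EFin) mabs abs0).
  by have /integrableP[] := (Lfun1_integrable _ _).1 X1.
rewrite EY /f/=; under eq_integral do rewrite EFinM.
rewrite integralZl//; apply/integrableP; split; first exact/measurable_EFinP.
rewrite (@ge0_integral_distribution _ _ _ _ _ P Y' (abse \o EFin) mabs abs0).
by have /integrableP[] := (Lfun1_integrable _ _).1 Y1.
Qed.

(** * Moments of bounded functions and moments computed through the law *)

Section law_transfer.
Local Open Scope ereal_scope.
Context d (T : measurableType d) (R : realType) (P : probability T R).
Implicit Type f : T -> R.

Lemma integrable_sqr_Lfun2 f : measurable_fun setT f ->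
  \int[P]_x (f x ^+ 2)%:E < +oo -> f \in Lfun P 2%:E.
Proof.
move=> mf f2; rewrite inE; apply/andP; split; first by rewrite inE.
rewrite inE/= /finite_norm unlock/=; apply: poweR_lty.
apply: le_lt_trans f2; rewrite le_eqVlt; apply/orP; left; apply/eqP.
by apply: eq_integral => x _; rewrite powR_mulrn// real_normK// num_real.
Qed.

Lemma bounded_Lfun2 f (C : R) : measurable_fun setT f ->
  (forall x, `|f x| <= C)%R -> f \in Lfun P 2%:E.
Proof.
move=> mf fC; apply: integrable_sqr_Lfun2 => //.
apply: (@le_lt_trans _ _ (\int[P]_x (C ^+ 2)%:E)); last first.
  by rewrite integral_cst//= probability_setT mule1 ltry.
apply: ge0_le_integral => //.
- by move=> x _; rewrite lee_fin sqr_ge0.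
- by apply/measurable_EFinP; exact: measurable_funX.
- by move=> x _; rewrite lee_fin -real_normK ?num_real// lerXn2r ?nnegrE//
    (le_trans _ (fC x)).
Qed.

Lemma bounded_variance_le f (C : R) : measurable_fun setT f ->
  (forall x, `|f x| <= C)%R -> 'V_P[f] <= (C ^+ 2)%:E.
Proof.
move=> mf fC; have f2 := bounded_Lfun2 mf fC; rewrite varianceE//.
have f1 := Lfun_subset12 (fin_num_measure P _ measurableT) f2.
apply: (@le_trans _ _ 'E_P[(f ^+ 2)%R]).
  rewrite -[leRHS]sube0 leeB// -(fineK (expectation_fin_num f1)) -EFin_expe lee_fin.
  exact: sqr_ge0.
rewrite -(expectation_cst P); apply: expectation_le => //.
- by rewrite expr2; exact: measurable_funM.
- by move=> x; exact: sqr_ge0.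
- by move=> x; exact: sqr_ge0.
- by apply: aeW => x; rewrite -[leLHS]real_normK ?num_real// lerXn2r ?nnegrE//
    (le_trans _ (fC x)).
Qed.

Variables (Q : probability R R) (W : T -> R).
Hypothesis mW : measurable_fun setT W.
Hypothesis lawW : forall A, measurable A -> P (W @^-1` A) = Q A.

Let W' : {mfun T >-> R} := mfun_Sub (mem_set mW).

Lemma law_ge0_integral (h : R -> \bar R) : measurable_fun setT h ->
  (forall x, 0 <= h x) -> \int[P]_t h (W t) = \int[Q]_x h x.
Proof.
move=> mh h0; rewrite -(@eq_measure_integral _ _ _ _ Q (distribution P W')).
  by rewrite ge0_integral_distribution.
by move=> A mA _; exact: lawW.
Qed.

Lemma law_Lfun2 (g : R -> R) : g \in Lfun Q 2%:E -> g \o W \in Lfun P 2%:E.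
Proof.
move=> g2; have mg := Lfun_measurable g2.
apply: integrable_sqr_Lfun2; first exact: measurableT_comp.
rewrite (@law_ge0_integral (fun x => (g x ^+ 2)%:E)).
- have /integrableP[_] := Lfun2_integrable_sqr g2.
  by apply: le_lt_trans; apply: ge0_le_integral => //;
    [move=> x _; rewrite lee_fin sqr_ge0 | apply/measurable_EFinP; exact: measurable_funX
    | apply: measurableT_comp => //; apply/measurable_EFinP; exact: measurable_funX
    | move=> x _; exact: lee_abs].
- by apply/measurable_EFinP; exact: measurable_funX.
- by move=> x; rewrite lee_fin sqr_ge0.
Qed.

Lemma law_expectation (g : R -> R) : g \in Lfun Q 2%:E -> 'E_P[g \o W] = 'E_Q[g].
Proof.
move=> g2; have mg := Lfun_measurable g2.
rewrite unlock -(@eq_measure_integral _ _ _ _ Q (distribution P W')); last first.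
  by move=> A mA _; exact: lawW.
rewrite integral_distribution//; first exact/measurable_EFinP.
by apply/Lfun1_integrable/Lfun_subset12; [exact: fin_num_measure|exact: law_Lfun2].
Qed.

Lemma law_variance (g : R -> R) : g \in Lfun Q 2%:E -> 'V_P[g \o W] = 'V_Q[g].
Proof.
move=> g2; have mg := Lfun_measurable g2.
rewrite /variance !covariance.unlock law_expectation//; set m := fine _.
rewrite expectation.unlock.
rewrite -(@law_ge0_integral (fun x => ((g x - m) * (g x - m))%:E))//.
- apply/measurable_EFinP; apply: measurable_funM; exact: measurable_funB.
- by move=> x; rewrite lee_fin -expr2 sqr_ge0.
Qed.

End law_transfer.

(** * Variables with a common law, up to translations under the second measure *)

Section translated_laws.
Local Open Scope ereal_scope.
Context d (T : measurableType d) (R : realType) (P Q : probability T R)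
  (al be : probability R R) (Z : nat -> T -> R) (s : nat -> R).
Hypothesis mZ : forall i, measurable_fun setT (Z i).
Hypothesis indP : forall i j A B, (i < j)%N -> measurable A -> measurable B ->
  P (Z i @^-1` A `&` Z j @^-1` B) = P (Z i @^-1` A) * P (Z j @^-1` B).
Hypothesis indQ : forall i j A B, (i < j)%N -> measurable A -> measurable B ->
  Q (Z i @^-1` A `&` Z j @^-1` B) = Q (Z i @^-1` A) * Q (Z j @^-1` B).
Hypothesis lawP : forall i A, measurable A -> P (Z i @^-1` A) = al A.
Hypothesis lawQ : forall i A, measurable A ->
  Q ((fun t => Z i t - s i)%R @^-1` A) = be A.
Hypothesis nsing : ~ mutually_singular P Q.

(** Since Z_i = (Z_i - s_i) + s_i, the variable f(Z_i) has under [Q] the moments of f(x + s_i) under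
    [be], and under [P] those of f under [al]. The second-moment criterion is thus rewritten in
    terms of the two fixed laws. *)
Lemma expectation_diff_sum_le (f : R -> R) (C : R) :
  f \in Lfun al 2%:E ->
  (forall i, (fun x => f (x + s i))%R \in Lfun be 2%:E) ->
  'V_al[f] <= C%:E -> (forall i, 'V_be[(fun x => f (x + s i))%R] <= C%:E) ->
  exists M : R, forall n, (\sum_(i < n)
    (fine 'E_be[(fun x => f (x + s i))] - fine 'E_al[f]) ^+ 2 <= M)%R.
Proof.
move=> fal fbe Vf Vfs; have mf := Lfun_measurable fal.
have ZsE i : f \o Z i = (fun x => f (x + s i)%R) \o (fun t => Z i t - s i)%R.
  by apply/funext => t /=; rewrite subrK.
have mZs i : measurable_fun setT (fun t => Z i t - s i)%R.
  exact: measurable_funB.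
have EP i : 'E_P[f \o Z i] = 'E_al[f] by apply: law_expectation => // A; exact: lawP.
have EQ i : 'E_Q[f \o Z i] = 'E_be[(fun x => f (x + s i))%R].
  by rewrite ZsE; apply: law_expectation => // A; exact: lawQ.
have LP i : f \o Z i \in Lfun P 2%:E by apply: law_Lfun2 fal => // A; exact: lawP.
have LQ i : f \o Z i \in Lfun Q 2%:E.
  by rewrite ZsE; apply: law_Lfun2 (fbe i) => // A; exact: lawQ.
have mfA A : measurable A -> measurable (f @^-1` A).
  by move=> mA; rewrite -[_ @^-1` _]setTI; exact: mf.
have [||||M HM] := @not_singular_sum_le _ _ _ P Q (fun i => f \o Z i) C LP LQ _ _ _ _ nsing.
- move=> i j ij; apply: independent_covariance0 => // A B mA mB.
  exact: indP ij (mfA A mA) (mfA B mB).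
- move=> i j ij; apply: independent_covariance0 => // A B mA mB.
  exact: indQ ij (mfA A mA) (mfA B mB).
- by move=> i; rewrite (@law_variance _ _ _ _ al)// => A; exact: lawP.
- by move=> i; rewrite ZsE (@law_variance _ _ _ _ be)// => A; exact: lawQ.
exists M => n; apply: le_trans (HM n).
by rewrite le_eqVlt; apply/orP; left; apply/eqP/eq_bigr => i _; rewrite EP EQ.
Qed.

End translated_laws.

(** * Truncation, and its mean as a detector of shifts *)

Section clamp.
Context (R : realType).

Definition clamp (L x : R) := Num.max (- L) (Num.min L x).

Lemma clamp_norm_le L x : 0 <= L -> `|clamp L x| <= L.
Proof.
move=> L0; rewrite /clamp ler_norml le_max lexx/= ge_max ge_min lexx/= andbT.
by rewrite lerNl (le_trans _ L0)// oppr_le0.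
Qed.

Lemma measurable_clamp L : measurable_fun setT (clamp L).
Proof. by apply: measurable_maxr => //; exact: measurable_minr. Qed.

Lemma clamp_homo L : {homo clamp L : x y / x <= y}.
Proof.
move=> x y xy; rewrite /clamp !(minEle, maxEle).
by repeat case: ifPn; rewrite -?ltNge => *; lra.
Qed.

Lemma clamp_id L x : `|x| <= L -> clamp L x = x.
Proof.
rewrite ler_norml /clamp => /andP[xL1 xL2].
by rewrite (min_idPr xL2) (max_idPr xL1).
Qed.

(** The level L + 1 leaves a margin of 1 around [-L, L], so a point of that interval can move by
    min(|s|, 1) before the truncation stops it. Allowing either shift to be zero treats both signs
    of s at once. *)
Lemma clamp_shift L x s1 s2 : `|x| <= L -> s1 <= s2 ->
  s1 = 0 \/ s2 = 0 ->
  Num.min `|s2 - s1| 1 <= clamp (L + 1) (x + s2) - clamp (L + 1) (x + s1).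
Proof.
move=> xL s12 s0; have cx : clamp (L + 1) x = x by apply: clamp_id; lra.
move: xL; rewrite ler_norml => /andP[xL1 xL2].
rewrite ger0_norm ?subr_ge0//; set m := Num.min _ _.
have ms : m <= s2 - s1 by rewrite /m ge_min lexx.
have m1 : m <= 1 by rewrite /m ge_min lexx orbT.
case: s0 => s0; subst; rewrite addr0 cx.
  by rewrite lerBrDr /clamp le_max le_min; apply/orP; right; apply/andP; split; lra.
rewrite lerBrDr addrC -lerBrDr /clamp ge_max ge_min.
by apply/andP; split; [lra|apply/orP; right; lra].
Qed.

End clamp.

(** Continuity from below along the intervals [-n, n], whose union has mass 1 > 1/2. *)
Lemma probability_norm_le_ge_half (R : realType) (al : probability R R) :
  exists2 L : R, 0 <= L & ((2^-1)%:E <= al [set x : R | (`|x| <= L)%R])%E.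
Proof.
pose F (n : nat) := [set x : R | `|x| <= n%:R].
have mF n : measurable (F n).
  rewrite (_ : F n = `[- n%:R, n%:R]%classic)//; apply/seteqP.
  by split=> x; rewrite /F/= in_itv/= ler_norml.
have UF : \bigcup_n F n = setT.
  apply/seteqP; split => // x _; exists (Num.truncn `|x|).+1 => //=.
  by rewrite /F/= ltW// truncnS_gt.
have cvgF : al (F n) @[n --> \oo] --> al (\bigcup_n F n).
  apply: nondecreasing_cvg_mu => //; first exact: bigcup_measurable.
  move=> m n mn; apply/subsetPset => x; rewrite /F/= => /le_trans; apply.
  by rewrite ler_nat.
have : ((2^-1)%:E < al (\bigcup_n F n))%E.
  by rewrite UF [ltRHS]probability_setT lte_fin; lra.
move=> h; have [N _ HN] : \forall n \near \oo, ((2^-1)%:E < al (F n))%E.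
  exact: (cvgF _ (open_ereal_gt' h)).
by exists N%:R => //; apply/ltW/(HN N) => /=.
Qed.

(** On [-L, L], of mass at least 1/2, a shift by s changes the truncated value by at least min(|s|,
    1). Elsewhere the change has the same sign because truncation is monotone, so nothing cancels in
    the mean. *)
Lemma clamp_expectation_shift (R : realType) (al : probability R R) :
  exists2 L : R, 0 <= L & forall s : R, Num.min `|s| 1 / 2 <=
    `|fine 'E_al[(fun x : R => clamp L (x + s))]%E - fine 'E_al[clamp L]%E|.
Proof.
have [L L0 aL] := probability_norm_le_ge_half al.
have L10 : 0 <= L + 1 by rewrite addr_ge0.
have mA : measurable [set x : R | `|x| <= L].
  rewrite (_ : mkset _ = `[- L, L]%classic)//; apply/seteqP.
  by split=> x; rewrite /= in_itv/= ler_norml.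
exists (L + 1) => // s.
have mc (s1 : R) : measurable_fun setT (fun x : R => clamp (L + 1) (x + s1)).
  by apply: (measurableT_comp (measurable_clamp (L + 1))); exact: measurable_funD.
have c1 s1 : (fun x : R => clamp (L + 1) (x + s1)) \in Lfun al 1.
  apply: (Lfun_subset12 (fin_num_measure al _ measurableT)).
  by apply: bounded_Lfun2 (fun x : R => clamp_norm_le (x + s1) L10).
have key (s1 s2 : R) : s1 <= s2 -> s1 = 0 \/ s2 = 0 -> Num.min `|s2 - s1| 1 / 2 <=
    fine 'E_al[(fun x : R => clamp (L + 1) (x + s2))]%E -
    fine 'E_al[(fun x : R => clamp (L + 1) (x + s1))]%E.
  move=> s12 s0; set m := Num.min _ _.
  have m0 : 0 <= m by rewrite /m le_min normr_ge0 ler01.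
  rewrite -fineB ?expectation_fin_num// -expectationB//.
  rewrite -lee_fin fineK ?expectation_fin_num ?rpredB//.
  (* The pointwise lower bound for the increment is m on [-L, L] and 0 outside. *)
  apply: (@le_trans _ _ 'E_al[(m \o* \1_[set x : R | (`|x| <= L)%R])%R]%E); last first.
    apply: expectation_le => //.
    - by apply: measurable_funM => //; exact: measurable_indic.
    - exact: measurable_funB.
    - by move=> x /=; rewrite mulr_ge0.
    - by move=> x /=; rewrite subr_ge0 clamp_homo// lerD2l.
    - apply: aeW => x /=; rewrite indicE; case: (boolP (x \in _)) => [/set_mem/= xL|_].
        by rewrite mul1r; exact: clamp_shift.
      by rewrite mul0r subr_ge0 clamp_homo// lerD2l.
  rewrite expectationZl; last first.
    apply: (Lfun_subset12 (fin_num_measure al _ measurableT)).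
    by apply: (@bounded_Lfun2 _ _ _ _ _ 1) => [|x];
      [exact: measurable_indic|rewrite indicE ger0_norm// lern1 leq_b1].
  by rewrite expectation_indic// EFinM lee_wpmul2l// lee_fin.
have -> : 'E_al[clamp (L + 1)]%E = 'E_al[(fun x : R => clamp (L + 1) (x + 0))]%E.
  by congr expectation; apply/funext => x; rewrite addr0.
have [s0|/ltW s0] := leP 0 s.
  have := key _ _ s0 (or_introl erefl); rewrite subr0.
  by move=> /le_trans; apply; exact: ler_norm.
have := key _ _ s0 (or_intror erefl); rewrite sub0r normrN distrC.
by move=> /le_trans; apply; exact: ler_norm.
Qed.

(** * From square-summable logarithmic shifts to the series of the theorem *)

(** For s >= 0, multiplying exp(-s) >= 1 - s by exp(s) gives exp(s) - 1 <= s exp(s), and 1 - s >=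
    1/2 gives exp(s) <= 2. For s < 0, exp(s) >= 1 + s is enough. *)
Lemma expR_sub1_le (R : realType) (s : R) : `|s| <= 2^-1 -> `|1 - expR s| <= 2 * `|s|.
Proof.
move=> s2; have s_ge := expR_ge1Dx s.
have [s0|s0] := leP 0 s.
  have e1 := expR_ge1Dx (- s); have ep := expR_gt0 s.
  have eN : expR s * expR (- s) = 1 by rewrite -expRD subrr expR0.
  move: s2; rewrite (ger0_norm s0) => s2; rewrite ler0_norm; last lra.
  nra.
have : expR s <= 1 by rewrite -expR0 ler_expR ltW.
by rewrite (ltr0_norm s0) => ?; rewrite ger0_norm; lra.
Qed.

(** The bound on the partial sums forces min(|s_n|, 1) to tend to 0. Hence |s_n| <= 1/2 from some
    rank on, and there the terms are at most 4 |s_n|^2. *)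
Lemma summable_expR (R : realType) (s : R^nat) (M : R) :
  (forall n, \sum_(i < n) (Num.min `|s i| 1) ^+ 2 <= M) ->
  (\sum_(1 <= n <oo) ((1 - expR (s n)) ^+ 2)%:E < +oo)%E.
Proof.
pose m i := (Num.min `|s i| 1) ^+ 2.
pose e i := (1 - expR (s i)) ^+ 2.
move=> sM; have m0 i : 0 <= m i by exact: sqr_ge0.
have e0 i : 0 <= e i by exact: sqr_ge0.
have serM n : series m n <= M by rewrite /series/= big_mkord.
have m_cvg : cvgn (series m).
  apply: nondecreasing_is_cvgn; first exact: nondecreasing_series.
  by exists M => _ [n _ <-].
(* Below 1/4 the square root is below 1/2, so the minimum with 1 is |s_n| itself. *)
have [N _ HN] : \forall n \near \oo, m n < 4^-1.
  by move/cvg_series_cvg_0: m_cvg => /cvgr_lt; apply; rewrite invr_gt0.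
have em n : (N <= n)%N -> e n <= 4 * m n.
  move=> /HN/=; rewrite /m /e => h.
  have s1 : `|s n| <= 2^-1 by move: h; rewrite minEle; case: ifP => _; nra.
  have {h}-> : Num.min `|s n| 1 = `|s n| by apply/min_idPl; lra.
  rewrite -[leLHS]real_normK ?num_real// (_ : 4 = 2 ^+ 2); last by ring.
  by rewrite -exprMn lerXn2r ?nnegrE ?mulr_ge0// expR_sub1_le.
have serE k : series e k <= series e N + 4 * M.
  have [kN|/ltnW/subnK<-] := leqP k N.
    rewrite -[leLHS]addr0 lerD//; first exact: nondecreasing_series.
    by rewrite mulr_ge0// (le_trans _ (serM 0%N))// /series/= big_geq.
  suff h j : series e (j + N)%N <= series e N + 4 * series m (j + N)%N.
    by apply: (le_trans (h _)); rewrite lerD2l ler_pM2l.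
  elim: j => [|j IH]; first by rewrite lerDl mulr_ge0// sumr_ge0.
  by rewrite addSn !seriesSr mulrDr addrA lerD// em// leq_addl.
apply: (@le_lt_trans _ _ (series e N + 4 * M)%:E); last exact: ltry.
apply: lime_le; first by apply: is_cvg_nneseries => n _ _; rewrite lee_fin sqr_ge0.
apply: nearW => k; rewrite sumEFin lee_fin; apply: le_trans (serE k).
(* [series e] starts at index 0 and the target series at 1; the extra term is nonnegative. *)
rewrite /series/=; case: k => [|k]; first by rewrite !big_geq.
by rewrite [leRHS]big_ltn// lerDr.
Qed.

(** * The two summability results for real variables *)

Section real_shifts.
Local Open Scope ereal_scope.
Context d (T : measurableType d) (R : realType) (P Q : probability T R)
  (al : probability R R) (Z : nat -> T -> R) (s : nat -> R).
Hypothesis mZ : forall i, measurable_fun setT (Z i).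
Hypothesis indP : forall i j A B, (i < j)%N -> measurable A -> measurable B ->
  P (Z i @^-1` A `&` Z j @^-1` B) = P (Z i @^-1` A) * P (Z j @^-1` B).
Hypothesis indQ : forall i j A B, (i < j)%N -> measurable A -> measurable B ->
  Q (Z i @^-1` A `&` Z j @^-1` B) = Q (Z i @^-1` A) * Q (Z j @^-1` B).
Hypothesis lawP : forall i A, measurable A -> P (Z i @^-1` A) = al A.
Hypothesis nsing : ~ mutually_singular P Q.

Lemma translates_summable :
  (forall i A, measurable A -> Q ((fun t => Z i t - s i)%R @^-1` A) = al A) ->
  \sum_(1 <= n <oo) ((1 - expR (s n)) ^+ 2)%:E < +oo.
Proof.
move=> lawQ; have [L L0 HL] := clamp_expectation_shift al.
have mc (r : R) : measurable_fun setT (fun x : R => clamp L (x + r)).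
  by apply: (measurableT_comp (measurable_clamp L)); exact: measurable_funD.
have cL r (x : R) : (`|clamp L (x + r)| <= L)%R by exact: clamp_norm_le.
have [||||M HM] := @expectation_diff_sum_le _ _ _ P Q al al Z s mZ indP indQ lawP lawQ
  nsing (clamp L) (L ^+ 2)%R.
- by apply: bounded_Lfun2 (fun x => clamp_norm_le x L0); exact: measurable_clamp.
- by move=> i; exact: bounded_Lfun2 (cL _).
- by apply: bounded_variance_le (fun x => clamp_norm_le x L0); exact: measurable_clamp.
- by move=> i; exact: bounded_variance_le (cL _).
(* The factor 4 is the inverse square of the 1/2 in [clamp_expectation_shift]. *)
apply: (@summable_expR _ _ (4 * M)%R) => n.
have := HM n; rewrite -(@ler_pM2l R 4)// mulr_sumr; apply: le_trans.
apply: ler_sum => i _.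
have := HL (s i); set D := (_ - _)%R; rewrite -(real_normK (num_real D)).
have : (0 <= Num.min `|s i| 1)%R by rewrite le_min normr_ge0 ler01.
set m := Num.min _ _; set D' := `|D|%R; nra.
Qed.

Lemma square_integrable_translates_summable (be : probability R R) :
  (forall i A, measurable A -> Q ((fun t => Z i t - s i)%R @^-1` A) = be A) ->
  \int[al]_x (x ^+ 2)%:E < +oo -> \int[be]_x (x ^+ 2)%:E < +oo ->
  exists c : R, \sum_(1 <= n <oo) ((1 - expR (s n - c)) ^+ 2)%:E < +oo.
Proof.
move=> lawQ al2 be2.
have ial : id \in Lfun al 2%:E by exact: integrable_sqr_Lfun2.
have ibe : id \in Lfun be 2%:E by exact: integrable_sqr_Lfun2.
have ibe1 := Lfun_subset12 (fin_num_measure be _ measurableT) ibe.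
(* One constant must bound the variances under both laws; translation does not change the one under
   [be]. *)
pose C := (fine 'V_al[id] + fine 'V_be[id])%R.
have Vbe (r : R) : 'V_be[(fun x => x + r)%R] = 'V_be[id].
  exact: (varianceD_cst_r r ibe).
have [||||M HM] := @expectation_diff_sum_le _ _ _ P Q al be Z s mZ indP indQ lawP lawQ
  nsing id C.
- exact: ial.
- move=> i; apply: (@rpredD _ (Lfun be 2%:E) id (cst (s i)));
    rewrite ?lee1n// => *; exact: Lfun_cst.
- rewrite -(fineK (variance_fin_num ial)) lee_fin lerDl fine_ge0//; exact: variance_ge0.
- move=> i; rewrite Vbe -(fineK (variance_fin_num ibe)) lee_fin.
  by rewrite lerDr fine_ge0//; exact: variance_ge0.
(* With this c, the difference of the means at coordinate i is exactly s_i - c. *)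
exists (fine 'E_al[id] - fine 'E_be[id])%R.
apply: (@summable_expR _ _ M) => n; apply: le_trans (HM n).
apply: ler_sum => i _.
have -> : fine 'E_be[(fun x => id (x + s i))%R] = (fine 'E_be[id] + s i)%R.
  rewrite (_ : (fun x => _) = (id \+ cst (s i))%R)// expectationD ?Lfun_cst//.
  by rewrite expectation_cst fineD// expectation_fin_num.
have -> : (fine 'E_be[id] + s i - fine 'E_al[id] =
           s i - (fine 'E_al[id] - fine 'E_be[id]))%R by ring.
set D := (s i - _)%R; rewrite -[leRHS](real_normK (num_real D)).
by rewrite lerXn2r ?nnegrE ?ge_min ?lexx// le_min normr_ge0 ler01.
Qed.

End real_shifts.

(** * Absolute value and Borel measurability on the scalars and on sequences *)

Lemma preimage_open_measurable (T : pointedType) (G : set (set T))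
    (U : ptopologicalType) (f : T -> U) :
  (forall B, open B -> G (f @^-1` B)) ->
  measurable_fun setT (f : g_sigma_algebraType G -> g_sigma_algebraType (@open U)).
Proof.
move=> Gf; apply: (@measurability _ _ (g_sigma_algebraType G) (g_sigma_algebraType (@open U))
  setT f (@open U)) => //.
by move=> _ [B oB <-]; rewrite setTI; apply: sub_sigma_algebra; exact: Gf.
Qed.

Section absK_theory.
Context (R : realType) (k : scalar_kind).
Implicit Types x y : Kfld R k.

Lemma absK0 : absK (0 : Kfld R k) = 0.
Proof. by case: k => /=; [exact: normr0|exact: Normc.normc0]. Qed.

Lemma absKM x y : absK (x * y) = absK x * absK y.
Proof. by case: k x y => /= x y; [exact: normrM|exact: Normc.normcM]. Qed.

Lemma absK_gt0 x : x != 0 -> 0 < absK x.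
Proof.
case: k x => /= x; first by rewrite normr_gt0.
move=> x0; have : 0 < `|x| by rewrite normr_gt0.
by case: x x0 => a b _; rewrite normc_def ltcE /= eqxx.
Qed.

Lemma absKV x : x != 0 -> absK x^-1 = (absK x)^-1.
Proof.
case: k x => /= x x0; first by rewrite normfV.
exact: Normc.normcV.
Qed.

Lemma absK_surjective (r : R) : 0 < r -> exists2 x : Kfld R k, x != 0 & absK x = r.
Proof.
case: k => /= r0; first by exists r; rewrite ?gt_eqF// gtr0_norm.
exists (r%:C)%C; first by rewrite fmorph_eq0 gt_eqF.
by rewrite /= expr0n addr0 sqrtr_sqr gtr0_norm.
Qed.

(** In the complex case this is the reverse triangle inequality; balls of [R[i]] have complex radii,
    so the real radius is embedded. *)
Lemma absK_continuous : continuous (@absK R k).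
Proof.
case: k; first exact: norm_continuous.
move=> x A /nbhs_ballP[e /= e0 eA].
have eC0 : 0 < (e%:C)%C :> R[i] by rewrite ltcR.
apply/nbhs_ballP; exists (e%:C)%C => // y.
rewrite /ball /= normc_def ltcR => h.
apply: eA; rewrite /ball/=; apply: le_lt_trans h.
have -> : Num.sqrt ((complex.Re (x - y)) ^+ 2 + (complex.Im (x - y)) ^+ 2) =
   Normc.normc (x - y) by case: (x - y).
have nB (z w : R[i]) : Normc.normc z - Normc.normc w <= Normc.normc (z - w).
  by rewrite lerBlDr -{1}(subrK w z); exact: le_normcD.
rewrite ler_norml nB andbT lerNl opprB; apply: le_trans (nB _ _) _.
by rewrite -(normcN (y - x)) opprB.
Qed.

Lemma measurable_absK : measurable_fun setT (@absK R k : KB R k -> R).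
Proof.
apply: (measurability _ (RGenOInfty.measurableE R)).
move=> _ [_ [x ->] <-]; rewrite setTI; apply: sub_sigma_algebra.
apply: open_comp => [y _|]; [exact: absK_continuous|].
by rewrite set_itvE; exact: open_gt.
Qed.

Lemma measurable_scale (c : Kfld R k) :
  measurable_fun setT ((fun x : Kfld R k => c * x) : KB R k -> KB R k).
Proof.
apply: preimage_open_measurable => B oB.
by apply: open_comp => // x _; exact: mulrl_continuous.
Qed.

(* The topology used in [KNB]; local to this section. *)
Import ArrowAsProduct.

Lemma measurable_coord n :
  measurable_fun setT ((fun t : nat -> Kfld R k => t n) : KNB R k -> KB R k).
Proof.
apply: preimage_open_measurable => B oB.
by apply: open_comp => // x _; exact: (@proj_continuous nat (fun=> Kfld R k) n).
Qed.

End absK_theory.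

(** Serves to discard the null event of a zero coordinate: ln 0 is 0 by convention, so ln |x y| = ln
    |x| + ln |y| may fail there. *)
Lemma measure_eq_off_null (d : measure_display) (T : measurableType d)
    (R : realType) (m : {measure set T -> \bar R}) (N A B : set T) :
  measurable N -> m N = 0%E -> measurable A -> measurable B ->
  (forall t, ~ N t -> A t <-> B t) -> m A = m B.
Proof.
move=> mN N0 mA mB AB.
have mD S : measurable S -> m S = m (S `\` N).
  move=> mS; transitivity (m (S `\` N) + m (S `&` N))%E; first exact: measureDI.
  have -> : m (S `&` N) = 0%E.
    by apply: (@subset_measure0 _ _ _ m _ N) => //; exact: measurableI.
  by rewrite adde0.
rewrite (mD A)// (mD B)//; congr (m _).
by apply/seteqP; split => t [/= St Nt]; split => //; exact/(AB t Nt).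
Qed.

Lemma measurable_zeroK (R : realType) (k : scalar_kind) :
  measurable ([set (0 : Kfld R k)] : set (KB R k)).
Proof.
rewrite (_ : set1 _ = setT `&` (@absK R k : KB R k -> R) @^-1` [set 0]).
  exact: measurable_absK.
rewrite setTI; apply/seteqP; split=> x /=; first by move=> ->; exact: absK0.
by apply: contraPP => /eqP /absK_gt0 x0; apply/eqP; rewrite gt_eqF.
Qed.

Lemma measurable_ln_absK (R : realType) (k : scalar_kind) :
  measurable_fun setT ((fun x => ln (absK x)) : KB R k -> R).
Proof.
by apply: (measurableT_comp (@measurable_ln R)); exact: measurable_absK.
Qed.

(** * Coordinates under an invariant product measure *)

Section invariant_product.
Local Open Scope ereal_scope.
Context (R : realType) (k : scalar_kind) (w : nat -> Kfld R k)
  (mu : nat -> probability (KB R k) R) (m : probability (KNB R k) R).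
Hypothesis w0 : forall n, w n != 0%R.
Hypothesis prod_m : is_product_measure m mu.

Lemma coord_law n (A : set (KB R k)) : measurable A ->
  m [set t : KNB R k | A (t n)] = mu n A.
Proof.
move=> mA; have := @prod_m n.+1 (fun l => if l == n then A else setT).
rewrite big_ord_recr/= eqxx big1 ?mul1e => [<-|i _].
- congr (m _); apply/seteqP; split => t /=.
    by move=> At i _; case: eqP => // ->.
  by move=> /(_ n (ltnSn n)); rewrite eqxx.
- by move=> i; case: ifP.
- by rewrite ltn_eqF ?ltn_ord// probability_setT.
Qed.

Lemma coord_independent i j (A B : set (KB R k)) : (i < j)%N ->
  measurable A -> measurable B ->
  m ([set t : KNB R k | A (t i)] `&` [set t : KNB R k | B (t j)]) =
  m [set t : KNB R k | A (t i)] * m [set t : KNB R k | B (t j)].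
Proof.
move=> ij mA mB; rewrite !coord_law//.
(* The event is a cylinder on the first j + 1 coordinates, unconstrained except at i and j. *)
have := @prod_m j.+1
  (fun l => if l == i then A else if l == j then B else setT).
rewrite big_ord_recr/= (gtn_eqF ij) eqxx (bigD1 (Ordinal ij))//= eqxx.
rewrite big1 ?mule1 => [<-|l li].
- congr (m _); apply/seteqP; split => t /=.
    by move=> [At Bt] l _; case: eqP => [->//|_]; case: eqP => [->|].
  move=> AB; split; first by have := AB i (ltnW ij); rewrite eqxx.
  by have := AB j (ltnSn j); rewrite (gtn_eqF ij) eqxx.
- by move=> l; case: ifP => // _; case: ifP.
- by rewrite -val_eqE/= in li; rewrite (negPf li) ltn_eqF ?ltn_ord// probability_setT.
Qed.

Hypothesis inv_m : shift_invariant w m.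

Let W n := (\prod_(1 <= i < n.+1) w i)%R.

Let W_neq0 n : W n != 0%R.
Proof. by rewrite /W prodf_seq_neq0; apply/allP => i _; rewrite w0. Qed.

Lemma measurable_scaled_coord n (c : Kfld R k) (A : set (KB R k)) :
  measurable A -> measurable [set t : KNB R k | A (c * t n)%R].
Proof.
move=> mA; have := measurable_coord (k := k) n measurableT (measurable_scale c measurableT mA).
by rewrite !setTI.
Qed.

(** Induction on n: the preimage under [Bw w] of the event for n is the event for n + 1, because W_n
    w_{n+1} = W_{n+1}. Invariance gives both the same measure; for n = 0 the product is empty. *)
Lemma scaled_coord_law n (A : set (KB R k)) : measurable A ->
  m [set t : KNB R k | A (W n * t n)%R] = mu 0%N A.
Proof.
elim: n => [|n IH] mA.
  rewrite -coord_law// /W big_geq//; congr (m _).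
  by apply/seteqP; split => t /=; rewrite mul1r.
have WS : W n.+1 = (W n * w n.+1)%R by rewrite /W big_nat_recr.
rewrite -IH// -[RHS]inv_m.
  by congr (m _); apply/seteqP; split => t /=; rewrite /Bw WS mulrA.
exact: measurable_scaled_coord.
Qed.

Hypothesis mu0 : mu 0%N [set (0 : Kfld R k)%R] = 0.

Lemma measurable_log_coord (r : R) n :
  measurable_fun setT ((fun t => r + ln (absK (t n)))%R : KNB R k -> R).
Proof.
apply: measurable_funD => //; apply: (measurableT_comp (@measurable_ln R)).
by apply: (measurableT_comp (@measurable_absK R k)); exact: measurable_coord.
Qed.

(** The offsets are arbitrary because the variables built from the weights [u] must be independent
    under [mV] too. *)
Lemma log_coord_independent (r : nat -> R) i j (A B : set R) : (i < j)%N ->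
  measurable A -> measurable B ->
  m ((fun t => r i + ln (absK (t i)))%R @^-1` A `&`
     (fun t => r j + ln (absK (t j)))%R @^-1` B) =
  m ((fun t => r i + ln (absK (t i)))%R @^-1` A) *
  m ((fun t => r j + ln (absK (t j)))%R @^-1` B).
Proof.
move=> ij mA mB.
have mr (s : R) C : measurable C -> measurable [set x : KB R k | C (s + ln (absK x))%R].
  move=> mC; rewrite -[X in measurable X]setTI; apply: measurable_funD => //.
  by apply: (measurableT_comp (@measurable_ln R)); exact: measurable_absK.
exact: (coord_independent ij (mr (r i) A mA) (mr (r j) B mB)).
Qed.

(** Off the null event W_n t_n = 0 the sum of logarithms is ln |W_n t_n|, and W_n t_n has law
    [mu 0]. *)
Lemma log_coord_law n (A : set R) : measurable A ->
  m ((fun t => ln (absK (W n)) + ln (absK (t n)))%R @^-1` A) =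
  mu 0%N [set x : KB R k | A (ln (absK x))].
Proof.
move=> mA; pose N := [set t : KNB R k | [set 0%R] (W n * t n)%R].
have mlnA : measurable [set x : KB R k | A (ln (absK x))].
  by rewrite -[X in measurable X]setTI; exact: measurable_ln_absK.
rewrite -(scaled_coord_law n)//; apply: (@measure_eq_off_null _ _ _ _ N).
- exact: (measurable_scaled_coord n (W n) (@measurable_zeroK R k)).
- exact: etrans (scaled_coord_law n (@measurable_zeroK R k)) mu0.
- by rewrite -[X in measurable X]setTI; exact: measurable_log_coord.
- exact: (measurable_scaled_coord n (W n) mlnA).
- move=> t /eqP; rewrite mulf_eq0 (negPf (W_neq0 n))/= => tn0.
  by rewrite absKM lnM ?posrE ?absK_gt0// W_neq0.
Qed.

End invariant_product.

(** * Reduction of the theorem to real shifts *)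

Theorem theorem6p11 (R : realType) (k : scalar_kind)
  (u v : nat -> Kfld R k)
  (hu : forall n, u n != 0) (hv : forall n, v n != 0)
  (muU muV : nat -> probability (KB R k) R)
  (mU mV : probability (KNB R k) R)
  (hmU : is_product_measure mU muU) (hmV : is_product_measure mV muV)
  (invU : shift_invariant u mU) (invV : shift_invariant v mV)
  (hU0 : muU 0%N [set (0 : Kfld R k)] = 0%E) (hV0 : muV 0%N [set (0 : Kfld R k)] = 0%E)
  (nsing : ~ mutually_singular mU mV) :
  let lam : nat -> Kfld R k := fun n =>
    (\prod_(1 <= i < n.+1) u i) / (\prod_(1 <= i < n.+1) v i) in
  (* (1) *)
  (forall a : Kfld R k, a != 0 ->
     (forall A : set (KB R k), measurable A ->
        muV 0%N A = muU 0%N [set a * x | x in A]) ->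
     (\sum_(1 <= n <oo) ((1 - absK (a^-1 * lam n)) ^+ 2)%:E < +oo)%E)
  /\
  (* (2) *)
  ((\int[muU 0%N]_(t in [set t : KB R k | (t : Kfld R k) != 0%R]) ((ln (absK t)) ^+ 2)%:E
      < +oo)%E ->
   (\int[muV 0%N]_(t in [set t : KB R k | (t : Kfld R k) != 0%R]) ((ln (absK t)) ^+ 2)%:E
      < +oo)%E ->
   exists a : Kfld R k, a != 0 /\
     (\sum_(1 <= n <oo) ((1 - absK (a^-1 * lam n)) ^+ 2)%:E < +oo)%E).
Proof.
move=> lam.
pose U n := \prod_(1 <= i < n.+1) u i.
pose V n := \prod_(1 <= i < n.+1) v i.
have prod_neq0 (w : nat -> Kfld R k) n :
    (forall i, w i != 0) -> \prod_(1 <= i < n.+1) w i != 0.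
  by move=> w0; rewrite prodf_seq_neq0; apply/allP => i _; rewrite w0.
have U0 n : U n != 0 by exact: prod_neq0.
have V0 n : V n != 0 by exact: prod_neq0.
have lam0 n : lam n != 0 by rewrite mulf_neq0 ?invr_eq0 ?U0 ?V0.
pose s n := ln (absK (lam n)).
have sE n : s n = ln (absK (U n)) - ln (absK (V n)).
  by rewrite /s absKM absKV ?V0// ln_div ?posrE ?absK_gt0 ?U0 ?V0.
pose Z n (t : KNB R k) := ln (absK (U n)) + ln (absK (t n)).
have mZ n : measurable_fun setT (Z n) by exact: measurable_log_coord.
pose logK : {mfun KB R k >-> R} := mfun_Sub (mem_set (@measurable_ln_absK R k)).
pose al := distribution (muU 0%N) logK.
pose be := distribution (muV 0%N) logK.
have indU i j A B := log_coord_independent hmU (fun n => ln (absK (U n)))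
  (i := i) (j := j) (A := A) (B := B).
have indV i j A B := log_coord_independent hmV (fun n => ln (absK (U n)))
  (i := i) (j := j) (A := A) (B := B).
have lawU i A : measurable A -> mU (Z i @^-1` A) = al A.
  exact: (log_coord_law hu hmU invU hU0).
(* Subtracting s_i replaces the weights of [u] by those of [v], which is what [mV]-invariance can
   handle. *)
have ZsE i : (fun t => Z i t - s i) = (fun t => ln (absK (V i)) + ln (absK (t i))).
  by apply/funext => t; rewrite /Z sE; ring.
have lawV i A : measurable A -> mV ((fun t => Z i t - s i) @^-1` A) = be A.
  by rewrite ZsE; exact: (log_coord_law hv hmV invV hV0).
have termE a n : a != 0 -> 1 - absK (a^-1 * lam n) = 1 - expR (s n - ln (absK a)).
  by move=> a0; rewrite expRB !lnK ?posrE ?absK_gt0// absKM absKV// mulrC.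
split=> [a a0 muVE|lnU2 lnV2].
  (* The hypothesis says that X_u is distributed as a X_v, so ln |X_v| + ln |a| has law [al]. Moving
     ln |a| into the shift gives both measures the same reference law. *)
  pose s' n := s n - ln (absK a).
  have lawV' i A : measurable A -> mV ((fun t => Z i t - s' i) @^-1` A) = al A.
    move=> mA.
    have mB : measurable [set r | A (r + ln (absK a))].
      rewrite -[X in measurable X]setTI.
      by apply: (@measurable_funD _ _ _ _ id (cst (ln (absK a)))).
    have mlnA : measurable [set x : KB R k | A (ln (absK x))].
      by rewrite -[X in measurable X]setTI; exact: measurable_ln_absK.
    have mS : measurable [set x : KB R k | A (ln (absK (a * x)))].
      by have := measurable_scale a measurableT mlnA; rewrite setTI.
    transitivity (be [set r | A (r + ln (absK a))]).
      rewrite -(lawV i)//; congr (mV _); apply/seteqP.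
      by split => t /=; rewrite /s' opprB addrA (addrAC (Z i t)).
    transitivity (muV 0%N [set x : KB R k | A (ln (absK (a * x)))]).
      transitivity (muV 0%N [set x : KB R k | A (ln (absK x) + ln (absK a))]) => //.
      (* The logarithm of a x splits only for x nonzero, hence almost surely for [muV 0]. *)
      apply: (@measure_eq_off_null _ (KB R k) R (muV 0%N) [set (0 : Kfld R k)]) => //.
      - exact: measurable_zeroK.
      - by rewrite -[X in measurable X]setTI; exact: (@measurable_ln_absK R k _ _ mB).
      - by move=> x /eqP x0; rewrite /= absKM lnM ?posrE ?absK_gt0// addrC.
    rewrite muVE//; congr (muU 0%N _); apply/seteqP; split => [_ [x Ax <-]//|x Ax].
    by exists (a^-1 * x); rewrite /= mulrA divff// mul1r.
  under eq_eseriesr do rewrite termE//.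
  exact: (translates_summable mZ indU indV lawU nsing lawV').
have sqr_law (mu : probability (KB R k) R) :
    (\int[mu]_(t in [set t : KB R k | (t : Kfld R k) != 0%R])
       ((ln (absK t)) ^+ 2)%:E < +oo)%E ->
    (\int[distribution mu logK]_x (x ^+ 2)%:E < +oo)%E.
  rewrite ge0_integral_distribution; last 2 first.
  - by apply/measurable_EFinP; exact: measurable_funX.
  - by move=> x; rewrite lee_fin sqr_ge0.
  (* Extending the integral from the nonzero scalars to all of them adds nothing, since ln |0| is 0
     by convention. *)
  rewrite integral_mkcond; apply: le_lt_trans; rewrite le_eqVlt; apply/orP; left.
  apply/eqP/eq_integral => x _; rewrite /patch /=.
  case: ifPn => //; rewrite notin_setE/= => /negP; rewrite negbK => /eqP ->.
  by rewrite absK0 ln0// expr0n.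
have [c Hc] := square_integrable_translates_summable mZ indU indV lawU nsing lawV
  (sqr_law _ lnU2) (sqr_law _ lnV2).
(* Only |a| enters the series, so any scalar of absolute value exp(c) will do. *)
have [a a0 aE] := @absK_surjective R k (expR c) (expR_gt0 c).
exists a; split=> //; under eq_eseriesr do rewrite termE// aE expRK.
exact: Hc.
Qed.
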